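(* For every integer $n\ge 2$, the polynomial $$s_{n,2}(x,\lambda)=\sum_{k=0}^2\frac{\sigma_k(x)\,\sigma_{2-k}(\lambda)}{\binom{n}{k}},\qquad x\in\mathbb{R}^n,\ \lambda\in\mathbb{R}^2,$$ in $n+2$ variables is $\mathbb{I}$-hyperbolic, where $\mathbb{I}=(1,\ldots,1)\in\mathbb{R}^{n+2}$.
   Context: $\sigma_k$ denotes the $k$-th elementary symmetric polynomial in the coordinates of its vector argument ($\sigma_0=1$). A polynomial $P\in\mathbb{R}[X_1,\ldots,X_N]$ is $v$-hyperbolic, for $v\in\mathbb{R}^N$, if $P$ is homogeneous, $P(v)>0$, and for every $x\in\mathbb{R}^N$ the one-variable polynomial $P(x+X\cdot v)\in\mathbb{R}[X]$ has only real roots. *)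

(* Defs.v *)
(* MathComp, with multivariate polynomials from multinomials and the complex
   numbers R[i] from real-closed. *)
From mathcomp Require Import all_boot all_order all_algebra.
From mathcomp Require Import reals.
From mathcomp Require Import mpoly.
From mathcomp Require Import complex.

Set Implicit Arguments.
Unset Strict Implicit.
Unset Printing Implicit Defensive.

Import GRing.Theory Num.Theory.

Local Open Scope ring_scope.

Section Hyperbolic.
Variable R : realType.

(* P(x + X v) as a polynomial in X: substitute x_i + v_i X for the i-th variable. *)
Definition line_restr N (P : {mpoly R[N]}) (x v : 'I_N -> R) : {poly R} :=
  mmap polyC (fun i => (x i)%:P + (v i) *: 'X) P.

Definition only_real_roots (p : {poly R}) : Prop :=
  forall z : R[i], root (map_poly (real_complex R) p) z -> complex.Im z = 0.

Definition hyperbolic N (v : 'I_N -> R) (P : {mpoly R[N]}) : Prop :=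
  [/\ P \is homog mdeg,
      0 < P.@[v] &
      forall x : 'I_N -> R, only_real_roots (line_restr P x v)].

(* The n + 2 variables are ordered as x_1, ..., x_n, lambda_1, lambda_2. *)
Definition sigma_x n (k : nat) : {mpoly R[n + 2]} :=
  mesym n R k \mPo [tuple 'X_(lshift 2 i) | i < n].

Definition sigma_lambda n (k : nat) : {mpoly R[n + 2]} :=
  mesym 2 R k \mPo [tuple 'X_(rshift n j) | j < 2].

Definition s2 n : {mpoly R[n + 2]} :=
  \sum_(k < 3) ('C(n, k)%:R)^-1 *: (sigma_x n k * sigma_lambda n (2 - k)).

End Hyperbolic.

(* Main.v *)
(* On x, sigma_2 is governed by the mean m and the variance: sigma_2(x) / C(n,2)
   = m^2 - W with W = sum_i (x_i - m)^2 / (n (n - 1)) nonnegative.  Hence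
   s_{n,2} = (m + lambda_1) (m + lambda_2) - W.  Translating along (1,...,1)
   leaves W fixed and shifts m, lambda_1, lambda_2 by t, so the restriction to
   a line is (a + 2 t) (b + 2 t) - W, which is real-rooted because W >= 0. *)
Require Import Defs.
From mathcomp Require Import all_boot all_order all_algebra.
From mathcomp Require Import reals.
From mathcomp Require Import mpoly.
From mathcomp Require Import complex.
From mathcomp Require Import ring lra.

Import Order.TTheory GRing.Theory Num.Theory.

Local Open Scope ring_scope.

(** Expand the square over ordered pairs: the diagonal gives the squares, and the other pairs are
    grouped by their underlying set, each two-element set coming from exactly two of them. *)
Lemma sqr_sum_sym2 (S : comPzRingType) (I : finType) (a : I -> S) :
  (\sum_i a i) ^+ 2 =
  \sum_i a i ^+ 2 + (\sum_(A : {set I} | #|A| == 2%N) \prod_(i in A) a i) *+ 2.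
Proof.
rewrite expr2 big_distrlr /= pair_bigA /=.
rewrite (bigID (fun p : I * I => p.1 == p.2)) /=; congr (_ + _).
  rewrite (reindex_onto (fun i : I => (i, i)) fst) /=.
    by apply: eq_big => i; rewrite !eqxx // expr2.
  by case=> i j /= /eqP ->.
rewrite (partition_big (fun p : I * I => [set p.1; p.2])
          (fun A : {set I} => #|A| == 2%N)) /=; last first.
  by move=> p np; rewrite cards2 np.
rewrite -sumrMnl; apply: eq_bigr => A /cards2P[x [y [nxy ->]]].
rewrite big_setU1 ?inE //= big_set1 mulr2n.
rewrite (bigD1 (x, y)) /=; last by rewrite nxy eqxx.
congr (_ + _); rewrite (bigD1 (y, x)) /=; last first.
  by rewrite eq_sym nxy setUC eqxx /= xpair_eqE negb_and [y == x]eq_sym nxy.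
rewrite big1 ?addr0 1?mulrC // => -[i j] /= /andP[/andP[/andP[nij /eqP e] n1] n2].
(* Both entries lie in [[set x; y]], and all four cases are excluded: equal entries by [nij], the
   two orderings of [x] and [y] by [n1] and [n2]. *)
have := set21 i j; have := set22 i j; rewrite e !inE.
by case/orP=> /eqP ej; case/orP=> /eqP ei;
  move: nij n1 n2; rewrite ei ej ?eqxx.
Qed.

Section QuadraticForm.
Variables (R : realType) (n : nat).
Local Notation P := {mpoly R[n + 2]}.

Lemma sigma_xE k : sigma_x R n k =
  \sum_(A : {set 'I_n} | #|A| == k) \prod_(i in A) ('X_(lshift 2 i) : P).
Proof.
rewrite /sigma_x /mesym raddf_sum; apply: eq_bigr => A _.
rewrite /= rmorph_prod; apply: eq_bigr => i _ /=.
by rewrite comp_mpolyXU -tnth_nth tnth_mktuple.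
Qed.

Definition mean_x : P := n%:R^-1 *: \sum_(i < n) 'X_(lshift 2 i).

Definition lambda (j : 'I_2) : P := 'X_(rshift n j).

(** Stated between polynomials rather than values, so that homogeneity, the value at the all-ones
    vector and the restriction to lines can all be read off from it. *)
Lemma s2E : (2 <= n)%N ->
  s2 R n = (mean_x + lambda ord0) * (mean_x + lambda ord_max)
    - (n%:R * n.-1%:R)^-1 *: \sum_(i < n) ('X_(lshift 2 i) - mean_x) ^+ 2.
Proof.
move=> hn.
have n0 : (n%:R : R) != 0 by rewrite pnatr_eq0 -lt0n; apply: leq_trans hn.
have n10 : (n.-1%:R : R) != 0.
  by rewrite pnatr_eq0 -lt0n -subn1 subn_gt0.
have nE : (n%:R : R) = n.-1%:R + 1.
  by rewrite natr1 prednK // (leq_trans _ hn).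
have b2 : ('C(n, 2)%:R : R)^-1 = 2 * (n%:R^-1 * n.-1%:R^-1).
  have : ('C(n, 2)%:R : R) * 2 = n%:R * n.-1%:R.
    by rewrite -!natrM mulnC bin2 mul2n halfK -?oddM;
      case: (n) hn => // k _ /=; rewrite oddM /= andNb subn0.
  move=> e; have c0 : ('C(n, 2)%:R : R) != 0.
    by rewrite pnatr_eq0 -lt0n bin_gt0.
  apply: (mulfI c0); rewrite mulfV // !mulrA e; field.
  by rewrite n10 n0.
have L0 : sigma_lambda R n 0 = 1.
  by rewrite /sigma_lambda mesym0E rmorph1.
have L1 : sigma_lambda R n 1 = lambda ord0 + lambda ord_max.
  rewrite /sigma_lambda mesym1E big_ord_recl big_ord1 rmorphD /=.
  rewrite !comp_mpolyXU -!tnth_nth !tnth_mktuple /lambda.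
  by congr (_ + 'X_(rshift n _)); apply: val_inj.
have L2 : sigma_lambda R n 2 = lambda ord0 * lambda ord_max.
  rewrite /sigma_lambda mesymnnE big_ord_recl big_ord1 rmorphM /=.
  rewrite !comp_mpolyXU -!tnth_nth !tnth_mktuple /lambda.
  by congr (_ * 'X_(rshift n _)); apply: val_inj.
have X0 : sigma_x R n 0 = 1 by rewrite /sigma_x mesym0E rmorph1.
set S := \sum_(i < n) ('X_(lshift 2 i) : P).
have X1 : sigma_x R n 1 = S.
  rewrite /sigma_x mesym1E raddf_sum; apply: eq_bigr => i _ /=.
  by rewrite comp_mpolyXU -tnth_nth tnth_mktuple.
have X2 := sqr_sum_sym2 _ _ (fun i : 'I_n => 'X_(lshift 2 i) : P).
rewrite -sigma_xE -/S in X2.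
set Q := \sum_i _ ^+ 2 in X2.
have V : \sum_(i < n) ('X_(lshift 2 i) - mean_x) ^+ 2
    = Q - mean_x * S *+ 2 + mean_x ^+ 2 *+ n.
  under eq_bigr do rewrite sqrrB.
  rewrite big_split sumrB /= sumr_const card_ord; congr (_ - _ + _).
  by rewrite sumrMnl -mulr_suml mulrC.
rewrite V /s2 !big_ord_recl big_ord0 /= L0 X0 !(L1, L2, X1) /bump /=.
set E := sigma_x R n _ in X2 *.
have -> : Q = S ^+ 2 - E *+ 2 by rewrite X2 addrK.
rewrite bin0 bin1 b2 invr1 invfM /mean_x -/S -!mul_mpolyC !rmorphM /= mpolyC1.
rewrite -[_ ^+ 2 *+ n]mulr_natr (rmorph_nat (mpolyC (n + 2) (R := R)) 2).
pose a : R := n%:R^-1; pose b : R := n.-1%:R^-1.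
rewrite -/a -/b; set A := mpolyC _ a; set B := mpolyC _ b.
(* The one relation needed between [A] and [B]: 1/(n-1) - 1/n = 1/(n(n-1)) gives [b - a = a * b],
   and the last term is [a * b] because [a * n = 1]. *)
have AB0 : B - A - A * B *+ 2 + A ^+ 2 * B * n%:R = 0.
  transitivity ((b - a - a * b *+ 2 + a ^+ 2 * b * n%:R)%:MP : P).
    by rewrite rmorphD !rmorphB rmorphMn !rmorphM rmorph_nat.
  rewrite (_ : _ - _ + _ = 0) ?rmorph0 // /a /b nE; field.
  by rewrite n10 -nE.
apply: subr0_eq.
(* The terms in [E] and in the lambdas cancel, so the two sides differ by a multiple of [S ^+ 2]
   only. *)
transitivity (A * S ^+ 2 * (B - A - A * B *+ 2 + A ^+ 2 * B * n%:R)); last first.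
  by rewrite AB0 mulr0.
ring.
Qed.

Lemma s2_dhomog : (2 <= n)%N -> s2 R n \is 2.-homog.
Proof.
move=> hn.
have X1 i : ('X_i : P) \is 1.-homog by rewrite dhomogX /= mdeg1.
have M1 : mean_x \is 1.-homog by apply/rpredZ/rpred_sum => i _; exact: X1.
rewrite s2E // rpredB //.
by apply: (dhomogM (d:=1) (e:=1)); apply: rpredD => //; exact: X1.
apply/rpredZ/rpred_sum => i _; rewrite expr2.
by apply: (dhomogM (d:=1) (e:=1)); apply: rpredB => //; exact: X1.
Qed.

End QuadraticForm.

(** At a root u + iv with v nonzero, the vanishing imaginary part forces a + 2u = -(b + 2u). The
    real part then reads -(a + 2u)^2 - 4v^2 = w, which contradicts w >= 0. *)
Lemma only_real_roots_shifted_quadratic (R : realType) (a b w : R) : 0 <= w ->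
  only_real_roots ((a%:P + 'X *+ 2) * (b%:P + 'X *+ 2) - w%:P).
Proof.
move=> w0 z.
rewrite rootE rmorphB rmorphM !rmorphD /= !map_polyC map_polyX !hornerE subr_eq0.
case: z => u v; rewrite eq_complex /= => /andP[/eqP re /eqP im].
apply/eqP/negPn/negP => v0.
have AB : (a + u + u) + (b + u + u) = 0.
  apply: (mulfI v0); rewrite mulr0; lra.
have v2 : 0 < v ^+ 2 by rewrite exprn_even_gt0.
have A2 := sqr_ge0 (a + u + u).
have BE : b + u + u = - (a + u + u) by lra.
rewrite BE in re; nra.
Qed.

Theorem proposition4p10 (R : realType) (n : nat) (hn : (2 <= n)%N) :
  hyperbolic (fun _ : 'I_(n + 2) => 1 : R) (s2 R n).
Proof.
have n0 : (n%:R : R) != 0 by rewrite pnatr_eq0 -lt0n; apply: leq_trans hn.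
split.
- exact: homogE (s2_dhomog R n hn).
(* At the all-ones vector the mean is 1 and every deviation vanishes, leaving (1 + 1)(1 + 1). *)
- have m1 : (mean_x R n).@[fun=> 1] = 1.
    rewrite mevalZ raddf_sum /=.
    under eq_bigr do rewrite mevalXU.
    by rewrite sumr_const card_ord mulVf.
  rewrite s2E // mevalB mevalM !mevalD m1 mevalZ raddf_sum /=.
  rewrite !mevalXU big1 ?mulr0 ?subr0.
    by rewrite mulr_gt0 ?addr_gt0.
  by move=> i _; rewrite rmorphXn /= mevalB mevalXU m1 subrr expr0n.
move=> x; pose m := n%:R^-1 * \sum_(i < n) x (lshift 2 i).
pose w := (n%:R * n.-1%:R)^-1 * \sum_(i < n) (x (lshift 2 i) - m) ^+ 2.
pose l j := x (rshift n j).
have lineE : line_restr (s2 R n) x (fun=> 1) =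
    ((m + l ord0)%:P + 'X *+ 2) * ((m + l ord_max)%:P + 'X *+ 2) - w%:P.
  (* Each variable and the mean gain the same ['X]: it cancels in the deviations and doubles in the
     two factors. *)
  have XE i : mmap polyC (fun i => (x i)%:P + 1 *: 'X) 'X_i = (x i)%:P + 'X.
    by rewrite mmapX mmap1U scale1r.
  have mE : mmap polyC (fun i => (x i)%:P + 1 *: 'X) (mean_x R n) = m%:P + 'X.
    rewrite mmapZ raddf_sum /=.
    under eq_bigr do rewrite XE.
    rewrite big_split sumr_const card_ord /= mulrDr -rmorph_sum -rmorphM /=.
    by rewrite -['X *+ n]mulr_natl mulrA -polyC_natr -polyCM mulVf // mul1r.
  rewrite s2E // /line_restr rmorphB rmorphM !rmorphD /= !mE !XE mmapZ.
  rewrite raddf_sum /=; congr (_ * _ - _).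
  - by rewrite /l; ring.
  - by rewrite /l; ring.
  rewrite /w polyCM rmorph_sum /=; congr (_ * _); apply: eq_bigr => i _.
  by rewrite rmorphXn rmorphB /= XE mE polyC_exp polyCB; ring.
rewrite lineE; apply: only_real_roots_shifted_quadratic.
rewrite mulr_ge0 ?invr_ge0 ?mulr_ge0 //.
by apply: sumr_ge0 => i _; apply: sqr_ge0.
Qed.
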